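(* Let $T=(T_n)$ and $S=(S_n)$ be the Kendall and Spearman correlation statistics, with asymptotic means $\mu_T,\mu_S$ and asymptotic variances $\sigma_T^2,\sigma_S^2$ (all defined in the context), for a family of continuous bivariate cdf's $(F_\theta)_{\theta\in\Theta}$, where $\Theta\subseteq\mathbb R$ is an open interval containing $0$. Suppose that the marginal cdf's do not depend on $\theta$, i.e. $G_\theta=G$ and $H_\theta=H$ for some cdf's $G,H$ and all $\theta\in\Theta$, and that $F_0(x,y)=G(x)H(y)$ for all real $x,y$. Suppose also that there is a neighborhood $\Theta_0\subseteq\Theta$ of $0$ such that $\sigma_T$ and $\sigma_S$ are continuous and strictly positive on $\Theta_0$, and $(\mu_T(\theta)-\mu_T(0))\,\theta>0$ and $(\mu_S(\theta)-\mu_S(0))\,\theta>0$ for all $\theta\in\Theta_0\setminus\{0\}$. Let $a_\theta(x,y):=F_\theta(x,y)-G(x)H(y)$. Then the following conditions are equivalent to one another: (I) $\mathsf{ARE}_{T,S}(0)=1$; (II) $\dfrac{\mathsf E_\theta a_\theta(X,Y)}{\mathsf E_0 a_\theta(X,Y)}\longrightarrow 1$ as $\theta\to0$; (III) $\dfrac{\int_{\mathbb R^2}(F_\theta-F_0)\,d(F_\theta-F_0)}{\int_{\mathbb R^2}(F_\theta-F_0)\,dF_0}\longrightarrow 0$ as $\theta\to0$; that is, $\dfrac{\int_{\mathbb R^2}a_\theta\,da_\theta}{\int_{\mathbb R^2}a_\theta\,dF_0}\longrightarrow 0$ as $\theta\to0$.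
   Context: For each $\theta\in\Theta$, $(X,Y),(X_1,Y_1),(X_2,Y_2),\dots$ are i.i.d. random points in $\mathbb R^2$ under a probability measure $\mathsf P_\theta$ (with expectation $\mathsf E_\theta$ and variance $\mathsf{Var}_\theta$), with continuous joint cdf $F_\theta(x,y)=\mathsf P_\theta(X\le x,Y\le y)$ and marginal cdf's $G_\theta(x)=\mathsf P_\theta(X\le x)$, $H_\theta(y)=\mathsf P_\theta(Y\le y)$. Kendall's statistic is $T_n=\binom n2^{-1}\sum_{1\le i<j\le n}\operatorname{sign}\big((X_i-X_j)(Y_i-Y_j)\big)$; Spearman's statistic $S_n$ ($n\ge3$) is Pearson's sample correlation coefficient computed from the ranks of the $X_i$'s among $X_1,\dots,X_n$ and the ranks of the $Y_i$'s among $Y_1,\dots,Y_n$. Their asymptotic means and variances are $$\mu_T(\theta)=4\,\mathsf E_\theta F_\theta(X,Y)-1,\qquad \sigma_T^2(\theta)=16\,\mathsf{Var}_\theta\big(2F_\theta(X,Y)-G_\theta(X)-H_\theta(Y)\big),$$ $$\mu_S(\theta)=12\,\mathsf E_\theta G_\theta(X)H_\theta(Y)-3,$$ $$\sigma_S^2(\theta)=144\,\mathsf{Var}_\theta\Big((1-G_\theta(X))(1-H_\theta(Y))+\int_{\mathbb R}F_\theta(X,y)\,dH_\theta(y)+\int_{\mathbb R}F_\theta(x,Y)\,dG_\theta(x)\Big),$$ with $\sigma_T,\sigma_S\ge0$. The (two-sided) asymptotic relative efficiency of $T$ relative to $S$ at $0$ is $$\mathsf{ARE}_{T,S}(0):=\frac{\sigma_S^2(0)}{\sigma_T^2(0)}\lim_{\theta\to0}\frac{(\mu_T(\theta)-\mu_T(0))^2}{(\mu_S(\theta)-\mu_S(0))^2},$$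 provided the limit exists in $[0,\infty]$; the assertion $\mathsf{ARE}_{T,S}(0)=1$ includes existence of the limit. Integrals $\int_{\mathbb R^2} g\,dF$ and $\int_{\mathbb R^2} g\,d(F_\theta-F_0)$ are Lebesgue–Stieltjes integrals with respect to the probability measure with cdf $F$, respectively the signed measure which is the difference of the probability measures with cdf's $F_\theta$ and $F_0$. *)

(* Defs.v *)
From HB Require Import structures.
From mathcomp Require Import all_boot all_order all_algebra.
From mathcomp Require Import all_classical all_reals all_analysis.
Import Order.TTheory GRing.Theory Num.Theory.
Import numFieldNormedType.Exports.

Set Implicit Arguments.
Unset Strict Implicit.
Unset Printing Implicit Defensive.

Local Open Scope classical_set_scope.
Local Open Scope ring_scope.

(* Integral against a signed measure through its Jordan decomposition; a Hahn
   decomposition is picked by choice, and [Hahn_decomposition_uniq] makes the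
   resulting measures independent of that choice. *)
Definition hahn_pos d (T : measurableType d) (R : realType)
    (nu : {charge set T -> \bar R}) : set T :=
  projT1 (cid (Hahn_decomposition nu)).

Definition hahn_neg d (T : measurableType d) (R : realType)
    (nu : {charge set T -> \bar R}) : set T :=
  projT1 (cid (projT2 (cid (Hahn_decomposition nu)))).

Lemma hahn_pos_negP d (T : measurableType d) (R : realType)
    (nu : {charge set T -> \bar R}) :
  hahn_decomposition nu (hahn_pos nu) (hahn_neg nu).
Proof. exact: (projT2 (cid (projT2 (cid (Hahn_decomposition nu))))). Qed.

Definition charge_integral d (T : measurableType d) (R : realType)
    (nu : {charge set T -> \bar R}) (g : T -> R) : R :=
  \int[jordan_pos (hahn_pos_negP nu)]_z g z
  - \int[jordan_neg (hahn_pos_negP nu)]_z g z.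

Definition charge_diff d (T : measurableType d) (R : realType)
    (mu mu' : probability T R) : {charge set T -> \bar R} :=
  cadd (charge_of_finite_measure mu) (copp (charge_of_finite_measure mu')).

Definition pair_rv d (Omega : measurableType d) (R : realType)
  (X Y : {mfun Omega >-> R}) (w : Omega) : R * R := (X w, Y w).

Lemma measurable_pair_rv d (Omega : measurableType d) (R : realType)
  (X Y : {mfun Omega >-> R}) : measurable_fun setT (pair_rv X Y).
Proof. by apply: measurable_fun_pair. Qed.

HB.instance Definition _ d (Omega : measurableType d) (R : realType)
  (X Y : {mfun Omega >-> R}) :=
  isMeasurableFun.Build _ _ _ _ (pair_rv X Y) (measurable_pair_rv X Y).

(* The law of (X, Y), i.e. the probability measure on R^2 whose cdf is
   [joint_cdf P X Y]. *)
Definition joint_law d (Omega : measurableType d) (R : realType)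
    (P : probability Omega R) (X Y : {mfun Omega >-> R}) :
    probability (R * R)%type R :=
  distribution P (pair_rv X Y).

Definition joint_cdf d (Omega : measurableType d) (R : realType)
    (P : probability Omega R) (X Y : {mfun Omega >-> R}) (x y : R) : R :=
  fine (P [set w | X w <= x /\ Y w <= y]).

Definition marginal_cdf d (Omega : measurableType d) (R : realType)
    (P : probability Omega R) (X : {mfun Omega >-> R}) (x : R) : R :=
  fine (cdf (X : {RV P >-> R}) x).

Definition mean d (Omega : measurableType d) (R : realType)
    (P : probability Omega R) (Z : Omega -> R) : R :=
  fine ('E_P[Z])%E.

Definition var d (Omega : measurableType d) (R : realType)
    (P : probability Omega R) (Z : Omega -> R) : R :=
  fine ('V_P[Z])%E.

Definition mu_T d (Omega : measurableType d) (R : realType)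
    (P : probability Omega R) (X Y : {mfun Omega >-> R}) : R :=
  4 * mean P (fun w => joint_cdf P X Y (X w) (Y w)) - 1.

Definition sigma2_T d (Omega : measurableType d) (R : realType)
    (P : probability Omega R) (X Y : {mfun Omega >-> R}) : R :=
  16 * var P (fun w => 2 * joint_cdf P X Y (X w) (Y w)
                       - marginal_cdf P X (X w) - marginal_cdf P Y (Y w)).

Definition sigma_T d (Omega : measurableType d) (R : realType)
    (P : probability Omega R) (X Y : {mfun Omega >-> R}) : R :=
  Num.sqrt (sigma2_T P X Y).

Definition mu_S d (Omega : measurableType d) (R : realType)
    (P : probability Omega R) (X Y : {mfun Omega >-> R}) : R :=
  12 * mean P (fun w => marginal_cdf P X (X w) * marginal_cdf P Y (Y w)) - 3.

Definition sigma2_S d (Omega : measurableType d) (R : realType)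
    (P : probability Omega R) (X Y : {mfun Omega >-> R}) : R :=
  144 * var P (fun w =>
    (1 - marginal_cdf P X (X w)) * (1 - marginal_cdf P Y (Y w))
    + \int[distribution P Y]_y joint_cdf P X Y (X w) y
    + \int[distribution P X]_x joint_cdf P X Y x (Y w)).

Definition sigma_S d (Omega : measurableType d) (R : realType)
    (P : probability Omega R) (X Y : {mfun Omega >-> R}) : R :=
  Num.sqrt (sigma2_S P X Y).

(* [is_ARE_TS P X Y r]: the limit defining the asymptotic relative efficiency
   of T relative to S at 0 exists in [0, +oo], and the efficiency equals r. *)
Definition is_ARE_TS d (Omega : measurableType d) (R : realType)
    (P : R -> probability Omega R) (X Y : {mfun Omega >-> R})
    (r : \bar R) : Prop :=
  exists2 l : \bar R,
    ((mu_T (P theta) X Y - mu_T (P 0) X Y) ^+ 2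
     / (mu_S (P theta) X Y - mu_S (P 0) X Y) ^+ 2)%:E @[theta --> 0^'] --> l
  & ((sigma2_S (P 0) X Y / sigma2_T (P 0) X Y)%:E * l = r)%E.

(* Main.v *)
(* Integrating the indicator of a lower orthant against P_theta x P_0 in both
   orders gives E_0 F_theta = 1 - E G(X) - E H(Y) + E_theta G(X) H(Y), and
   E G(X) = E H(Y) = 1/2. Writing A = E_theta a_theta and B = E_0 a_theta, this
   yields mu_S(theta) - mu_S(0) = 12 B and mu_T(theta) - mu_T(0) = 4 (A + B).
   Under independence sigma_S^2 = (9/4) sigma_T^2, so the efficiency is the limit
   of ((A / B + 1) / 2)^2, where A / B + 1 > 0 by the sign conditions; and the
   ratio in (III) is A / B - 1. *)
Require Import Defs.
From HB Require Import structures.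
From mathcomp Require Import all_boot all_order all_algebra.
From mathcomp Require Import all_classical all_reals all_analysis.
From mathcomp Require Import ring lra measurable_realfun.
Import Order.TTheory GRing.Theory Num.Theory.
Import numFieldNormedType.Exports.

Local Open Scope classical_set_scope.
Local Open Scope ring_scope.

(** * Bounded measurable functions *)

Section bounded_measurable.
Context {d : measure_display} {T : measurableType d} {R : realType}.
Implicit Types (f g : T -> R) (mu : {finite_measure set T -> \bar R}).

(** Every integrand of the development lies in this class. It is stable under sums, products and
    measurable substitution, and it refers to no measure, so one proof of membership gives
    integrability under all the measures [P theta] and under both Jordan parts. *)
Definition bounded_measurable f :=
  measurable_fun setT f /\ exists M, forall t, `|f t| <= M.

Lemma bounded_measurable_cst (c : R) : bounded_measurable (fun=> c).
Proof. by split; [exact: measurable_cst | exists `|c|]. Qed.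

Lemma bounded_measurableD f g : bounded_measurable f -> bounded_measurable g ->
  bounded_measurable (fun t => f t + g t).
Proof.
move=> [mf [M fM]] [mg [N gN]]; split; first exact: measurable_funD.
by exists (M + N) => t; rewrite (le_trans (ler_normD _ _))// lerD.
Qed.

Lemma bounded_measurableM f g : bounded_measurable f -> bounded_measurable g ->
  bounded_measurable (fun t => f t * g t).
Proof.
move=> [mf [M fM]] [mg [N gN]]; split; first exact: measurable_funM.
by exists (M * N) => t; rewrite normrM ler_pM.
Qed.

Lemma bounded_measurableB f g : bounded_measurable f -> bounded_measurable g ->
  bounded_measurable (fun t => f t - g t).
Proof.
move=> [mf [M fM]] [mg [N gN]]; split; first exact: measurable_funB.
by exists (M + N) => t; rewrite (le_trans (ler_normB _ _))// lerD.
Qed.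

Lemma bounded_measurable_integrable mu f :
  bounded_measurable f -> mu.-integrable setT (EFin \o f).
Proof.
move=> [mf [M fM]]; apply: measurable_bounded_integrable => //.
  by rewrite ltey_eq fin_num_measure.
exists M; split; first by rewrite num_real.
by move=> x Mx t _ /=; rewrite (le_trans (fM t))// ltW.
Qed.

End bounded_measurable.

Lemma bounded_measurable_comp {d d' : measure_display} {T : measurableType d}
    {T' : measurableType d'} {R : realType} (f : T' -> R) (h : T -> T') :
  bounded_measurable f -> measurable_fun setT h ->
  bounded_measurable (fun t => f (h t)).
Proof.
move=> [mf [M fM]] mh; split; first exact: measurableT_comp.
by exists M => t.
Qed.

(** * Linearity of the mean and affine scaling of the variance *)

Section mean.
Context {d : measure_display} {Omega : measurableType d} {R : realType}.
Variable P : probability Omega R.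
Implicit Types f g : Omega -> R.

Lemma meanE f : mean P f = \int[P]_w f w.
Proof. by rewrite /mean unlock. Qed.

Lemma meanD f g : bounded_measurable f -> bounded_measurable g ->
  mean P (fun w => f w + g w) = mean P f + mean P g.
Proof.
by move=> bf bg; rewrite !meanE RintegralD//; exact: bounded_measurable_integrable.
Qed.

Lemma meanB f g : bounded_measurable f -> bounded_measurable g ->
  mean P (fun w => f w - g w) = mean P f - mean P g.
Proof.
by move=> bf bg; rewrite !meanE RintegralB//; exact: bounded_measurable_integrable.
Qed.

Lemma meanZ (c : R) f : bounded_measurable f ->
  mean P (fun w => c * f w) = c * mean P f.
Proof.
by move=> bf; rewrite !meanE RintegralZl//; exact: bounded_measurable_integrable.
Qed.

Lemma mean_cst (c : R) : mean P (fun=> c) = c.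
Proof. by rewrite meanE Rintegral_cst//= probability_setT mulr1. Qed.

Lemma varE f : var P f = mean P (fun w => (f w - mean P f) ^+ 2).
Proof. by rewrite /var /variance [in LHS]unlock. Qed.

Lemma var_affine (c e : R) f : bounded_measurable f ->
  var P (fun w => c * f w + e) = c ^+ 2 * var P f.
Proof.
move=> bf; rewrite !varE meanD ?meanZ ?mean_cst//; last first.
- exact: bounded_measurable_cst.
- by apply: bounded_measurableM => //; exact: bounded_measurable_cst.
have bc : bounded_measurable (fun w => f w - mean P f).
  by apply: bounded_measurableB => //; exact: bounded_measurable_cst.
rewrite -[RHS]meanZ; last exact: (bounded_measurableM _ _ bc bc).
by congr mean; apply/funext => w; ring.
Qed.

End mean.

(** * Integration against a difference of two probability measures *)

Lemma charge_integral_diff {d : measure_display} {T : measurableType d}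
    {R : realType} (mu mu' : probability T R) (g : T -> R) :
  bounded_measurable g ->
  charge_integral (charge_diff mu mu') g = \int[mu]_z g z - \int[mu']_z g z.
Proof.
move=> bg; rewrite /charge_integral.
set nu := charge_diff mu mu'.
pose jp : {finite_measure set T -> \bar R} := jordan_pos (hahn_pos_negP nu).
pose jn : {finite_measure set T -> \bar R} := jordan_neg (hahn_pos_negP nu).
transitivity (\int[jp]_z g z - \int[jn]_z g z); first by [].
(* The Jordan identity mu - mu' = jp - jn is rearranged into an equality of two sums of positive
   measures. Integrals are additive in such sums, and finiteness allows the terms to be moved back
   afterwards. *)
have jordanE A : measurable A ->
    measure_add mu jn A = measure_add mu' jp A.
  move=> mA.
  have : (mu A - mu' A = jp A - jn A)%E.
    rewrite -[LHS]/(nu A) (jordan_decomp (hahn_pos_negP nu) mA).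
    by rewrite -[LHS]/(jp A + cscale (-1) jn A)%E cscaleN1.
  have fin (m : {finite_measure set T -> \bar R}) : m A \is a fin_num.
    exact: fin_num_measure.
  suff : (mu A - mu' A = jp A - jn A -> mu A + jn A = mu' A + jp A)%E.
    by move=> h /h; rewrite !measure_addE.
  rewrite -(fineK (fin mu)) -(fineK (fin mu')) -(fineK (fin jp)) -(fineK (fin jn)).
  by rewrite -!EFinN -!EFinD => -[h]; congr EFin; lra.
have : (\int[measure_add mu jn]_z (g z)%:E =
        \int[measure_add mu' jp]_z (g z)%:E)%E.
  by apply: eq_measure_integral => A mA _; exact: jordanE.
have mg : measurable_fun setT (EFin \o g) by apply/measurable_EFinP; case: bg.
have ig (m : {finite_measure set T -> \bar R}) : m.-integrable setT (EFin \o g).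
  exact: bounded_measurable_integrable.
have fin (m : {finite_measure set T -> \bar R}) :
    (\int[m]_z (g z)%:E)%E \is a fin_num.
  exact: (integrable_fin_num _ (ig m)).
rewrite (integral_measure_add measurableT (ig mu) (ig jn))//.
rewrite (integral_measure_add measurableT (ig mu') (ig jp))//.
move=> /(congr1 fine).
rewrite (fineD (fin mu) (fin jn)) (fineD (fin mu') (fin jp)) /Rintegral; lra.
Qed.

(** * Tonelli for sections, and real-valued forms of measure identities *)

Lemma Rintegral_section_swap {d1 d2 : measure_display} {T1 : measurableType d1}
    {T2 : measurableType d2} {R : realType} (P : probability T1 R)
    (Q : probability T2 R) (A : set (T1 * T2)) : measurable A ->
  \int[Q]_y fine (P (ysection A y)) = \int[P]_x fine (Q (xsection A x)).
Proof.
move=> mA; congr fine; have := indic_fubini_tonelli P Q mA.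
rewrite indic_fubini_tonelli_FE// indic_fubini_tonelli_GE// => h.
have -> : (\int[Q]_y (fine (P (ysection A y)))%:E)%E
    = (\int[Q]_y (P \o ysection A) y)%E.
  apply: eq_integral => y _; rewrite fineK//.
  by apply: fin_num_measure; exact: measurable_ysection.
rewrite -h; apply: eq_integral => x _; rewrite fineK//.
by apply: fin_num_measure; exact: measurable_xsection.
Qed.

Lemma measurable_set_le {d : measure_display} {T : measurableType d}
    {R : realType} (f g : T -> R) :
  measurable_fun setT f -> measurable_fun setT g ->
  measurable [set t | f t <= g t].
Proof.
move=> mf mg; rewrite -[X in measurable X]setTI.
exact: (measurable_fun_ler mf mg measurableT (Y := [set true])).
Qed.

Lemma fine_probability_setC {d : measure_display} {T : measurableType d}
    {R : realType} (P : probability T R) (A : set T) :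
  measurable A -> fine (P (~` A)) = 1 - fine (P A).
Proof.
by move=> mA; rewrite probability_setC// fineB// fin_num_measure.
Qed.

Lemma fine_probability_setU {d : measure_display} {T : measurableType d}
    {R : realType} (P : probability T R) (A B : set T) :
  measurable A -> measurable B ->
  fine (P (A `|` B)) = fine (P A) + fine (P B) - fine (P (A `&` B)).
Proof.
move=> mA mB; have mAB : measurable (A `&` B) by exact: measurableI.
rewrite measureUfinr//; last by rewrite ltey_eq fin_num_measure.
by rewrite fineB ?fineD ?fin_numD ?fin_num_measure.
Qed.

(** * Joint and marginal cdf's *)

Section cdf.
Context {d : measure_display} {Omega : measurableType d} {R : realType}.
Implicit Types (P Q : probability Omega R) (X Y : {mfun Omega >-> R}).

Lemma measurable_le_cst X x : measurable [set w | X w <= x].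
Proof. exact: measurable_set_le. Qed.

Lemma measurable_eq_cst X x : measurable [set w | X w = x].
Proof.
rewrite -[E in measurable E]setTI.
exact: (measurable_funPT X measurableT [set x] (measurable_set1 x)).
Qed.

(** The cdf at z is the [P]-measure of the section at z of one measurable subset of Omega x R^2, and
    section measures depend measurably on the point. *)
Lemma joint_cdf_bounded_measurable P X Y :
  bounded_measurable (fun z : R * R => joint_cdf P X Y z.1 z.2).
Proof.
split; last first.
  exists 1 => z.
  have mS : measurable [set w | X w <= z.1 /\ Y w <= z.2].
    by apply: measurableI; exact: measurable_le_cst.
  rewrite ger0_norm ?fine_ge0// -lee_fin fineK ?probability_le1//.
  exact: fin_num_measure.
pose A := [set t : Omega * (R * R) | X t.1 <= t.2.1 /\ Y t.1 <= t.2.2].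
have mA : measurable A.
  by apply: measurableI; apply: measurable_set_le; exact: measurableT_comp.
have := measurable_fun_ysection P mA.
move=> /(measurableT_comp (fine_measurable (R := R) measurableT)).
rewrite (_ : _ \o _ = fun z : R * R => joint_cdf P X Y z.1 z.2)//.
apply/funext => z; congr (fine (P _)).
by apply/seteqP; split => w /=; rewrite /ysection /= inE.
Qed.

Lemma marginal_cdfE P X x : marginal_cdf P X x = fine (P [set w | X w <= x]).
Proof. by congr (fine (P _)); apply/seteqP; split => w /=; rewrite in_itv. Qed.

(** Makes statements about one variable the diagonal case [Y = X] of statements about pairs. *)
Lemma joint_cdf_self P X x : joint_cdf P X X x x = marginal_cdf P X x.
Proof.
by rewrite marginal_cdfE; congr (fine (P _)); apply/seteqP; split => w /=; tauto.
Qed.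

Lemma marginal_cdf_bounded_measurable P X : bounded_measurable (marginal_cdf P X).
Proof.
have -> : marginal_cdf P X = fun x => joint_cdf P X X x x.
  by apply/funext => x; rewrite joint_cdf_self.
apply: (bounded_measurable_comp (fun z => joint_cdf P X X z.1 z.2)
  (fun x : R => (x, x))); first exact: joint_cdf_bounded_measurable.
exact: measurable_fun_pair.
Qed.

Lemma bounded_measurable_joint_cdf P X Y :
  bounded_measurable (fun w => joint_cdf P X Y (X w) (Y w)).
Proof.
apply: (bounded_measurable_comp (fun z => joint_cdf P X Y z.1 z.2)
  (pair_rv X Y)); first exact: joint_cdf_bounded_measurable.
exact: measurable_pair_rv.
Qed.

Lemma bounded_measurable_marginal_cdf P X :
  bounded_measurable (fun w => marginal_cdf P X (X w)).
Proof.
by apply: bounded_measurable_comp => //; exact: marginal_cdf_bounded_measurable.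
Qed.

(** For t < x the atom at x has mass at most G(x) - G(t), which left continuity makes arbitrarily
    small. *)
Lemma continuous_cdf_atomless P X (x : R) :
  continuous (marginal_cdf P X) -> P [set w | X w = x] = 0%E.
Proof.
move=> cG.
have mx : measurable [set w | X w = x].
  exact: measurable_eq_cst.
have fE (A : set Omega) : measurable A -> P A = (fine (P A))%:E.
  by move=> mA; rewrite fineK// fin_num_measure.
rewrite fE//; congr (_%:E); apply/eqP; rewrite eq_le fine_ge0// andbT.
apply/ler_addgt0Pl => e e0; rewrite addr0.
have := cvg_at_left_filter (cG x) => /cvgrPdist_lt/(_ e e0) ne.
near x^'- => t.
have tx : t < x by near: t; exact: nbhs_left_lt.
have : `|marginal_cdf P X x - marginal_cdf P X t| < e by near: t.
rewrite ltr_norml => /andP[_ /ltW]; apply: le_trans.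
rewrite !marginal_cdfE lerBrDr -lee_fin EFinD -!fE//;
  do ?exact: measurable_le_cst.
have mt : measurable [set w | X w <= t] by exact: measurable_le_cst.
rewrite -measureU//; last first.
  by apply/seteqP; split => // w [/= ->]; rewrite leNgt tx.
apply: le_measure; rewrite ?inE; [exact: measurableU|exact: measurable_le_cst|].
move=> w /= [->|Xt]; rewrite /= ?lexx//.
exact: le_trans Xt (ltW tx).
Unshelve. all: by end_near.
Qed.

(** Up to boundary lines, which are null for atomless marginals, the closed upper orthant is the
    complement of {X <= x} or {Y <= y}; inclusion-exclusion does the rest. *)
Lemma upper_orthantE P X Y (x y : R) :
  continuous (marginal_cdf P X) -> continuous (marginal_cdf P Y) ->
  fine (P [set w | x <= X w /\ y <= Y w]) =
  1 - marginal_cdf P X x - marginal_cdf P Y y + joint_cdf P X Y x y.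
Proof.
move=> cG cH.
pose N := [set w | X w = x] `|` [set w | Y w = y].
have mlX : measurable [set w | X w <= x] by exact: measurable_le_cst.
have mlY : measurable [set w | Y w <= y] by exact: measurable_le_cst.
have mX : measurable [set w | X w = x].
  exact: measurable_eq_cst.
have mY : measurable [set w | Y w = y].
  exact: measurable_eq_cst.
have mN : measurable N by exact: measurableU.
have N0 : P N = 0%E by apply: null_set_setU => //; exact: continuous_cdf_atomless.
have mU : measurable ([set w | X w <= x] `|` [set w | Y w <= y]).
  exact: measurableU.
transitivity (fine (P (~` ([set w | X w <= x] `|` [set w | Y w <= y])))).
  have mUC := measurableC mU.
  have mV : measurable [set w | x <= X w /\ y <= Y w].
    by apply: measurableI; apply: measurable_set_le.
  (* The two sets differ only inside the null set [N], so adjoining [N] to each makes them equal. *)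
  congr fine; rewrite -(measureU0 mV mN N0) -(measureU0 mUC mN N0).
  congr (P _); apply/seteqP; split => w /= [|Nw]; try by right.
  - case=> xX yY.
    have [Xx|nX] := eqVneq (X w) x; first by right; left.
    have [Yy|nY] := eqVneq (Y w) y; first by right; right.
    left; case; apply/negP; rewrite -ltNge lt_neqAle eq_sym.
      by rewrite nX xX.
    by rewrite nY yY.
  - move=> nU; left; split; rewrite leNgt; apply/negP => /ltW ?; apply: nU.
      by left.
    by right.
rewrite fine_probability_setC// fine_probability_setU// !marginal_cdfE.
by rewrite -[fine (P (_ `&` _))]/(joint_cdf P X Y x y); lra.
Qed.

(* Fubini for the indicator of [X t.1 <= X t.2 /\ Y t.1 <= Y t.2] on
   [Omega * Omega]; absence of atoms lets the upper orthant be expressed by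
   the cdf's. *)
Lemma mean_joint_cdf_swap P Q X Y :
  continuous (marginal_cdf Q X) -> continuous (marginal_cdf Q Y) ->
  mean Q (fun w => joint_cdf P X Y (X w) (Y w)) =
  1 - mean P (fun w => marginal_cdf Q X (X w))
    - mean P (fun w => marginal_cdf Q Y (Y w))
    + mean P (fun w => joint_cdf Q X Y (X w) (Y w)).
Proof.
move=> cG cH; rewrite meanE.
pose A := [set t : Omega * Omega | X t.1 <= X t.2 /\ Y t.1 <= Y t.2].
have mA : measurable A.
  by apply: measurableI; apply: measurable_set_le; exact: measurableT_comp.
transitivity (\int[P]_w fine (Q (xsection A w))).
  rewrite -Rintegral_section_swap//; apply: eq_Rintegral => w _.
  congr (fine (P _)).
  by apply/seteqP; split => v /=; rewrite /ysection /= inE.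
have bG := bounded_measurable_marginal_cdf Q X.
have bH := bounded_measurable_marginal_cdf Q Y.
have bF := bounded_measurable_joint_cdf Q X Y.
have b1 := bounded_measurable_cst (T := Omega) (1 : R).
(* The right-hand side is gathered into a single mean under [P], whose integrand is the upper
   orthant probability under [Q]. *)
rewrite -[X in X - _ - _](mean_cst P) -meanB// -meanB//;
  last exact: bounded_measurableB.
rewrite -meanD//; last by do 2 apply: bounded_measurableB => //.
rewrite meanE; apply: eq_Rintegral => w _; rewrite -upper_orthantE//.
congr (fine (Q _)).
by apply/seteqP; split => v /=; rewrite /xsection /= inE.
Qed.

(* For [Y = X] the swap identity reads E G(X) = 1 - E G(X) - E G(X) + E G(X). *)
Lemma mean_marginal_cdf P X : continuous (marginal_cdf P X) ->
  mean P (fun w => marginal_cdf P X (X w)) = 2^-1.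
Proof.
move=> cG; have := mean_joint_cdf_swap P P X X cG cG.
under eq_fun do rewrite joint_cdf_self.
lra.
Qed.

End cdf.

(** * Change of variables to the law of a random element *)

Lemma Rintegral_distribution {d d' : measure_display} {Omega : measurableType d}
    {T : measurableType d'} {R : realType} (P : probability Omega R)
    (X : {mfun Omega >-> T}) (g : T -> R) : bounded_measurable g ->
  \int[distribution P X]_z g z = mean P (fun w => g (X w)).
Proof.
move=> bg; rewrite meanE; congr fine; rewrite integral_distribution//.
  by apply/measurable_EFinP; case: bg.
apply: (bounded_measurable_integrable P (g \o X)).
by apply: bounded_measurable_comp.
Qed.

Lemma joint_lawE {d : measure_display} {Omega : measurableType d}
    {R : realType} (P : probability Omega R) (X Y : {mfun Omega >-> R})
    (g : R * R -> R) : bounded_measurable g ->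
  \int[joint_law P X Y]_z g z = mean P (fun w => g (X w, Y w)).
Proof. by move=> bg; rewrite Rintegral_distribution. Qed.

(** * Independence under [Q], and a second law [P] with the same marginals *)

Section independence.
Context {d : measure_display} {Omega : measurableType d} {R : realType}.
Variables (Q : probability Omega R) (X Y : {mfun Omega >-> R}).
Hypothesis indep : forall x y,
  joint_cdf Q X Y x y = marginal_cdf Q X x * marginal_cdf Q Y y.

(** Supplies the nonzero divisor by which one marginal is recovered from the product cdf. *)
Lemma exists_marginal_cdf_gt0 (Z : {mfun Omega >-> R}) :
  exists z, 0 < marginal_cdf Q Z z.
Proof.
have : marginal_cdf Q Z x @[x --> +oo] --> (1 : R).
  by apply: fine_cvg; exact: cvg_cdfy1.
move=> /cvgrPdist_lt/(_ 1 ltr01) h; near (@pinfty_nbhs R) => z; exists z.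
have : `|1 - marginal_cdf Q Z z| < 1 by near: z.
by rewrite ltr_norml => /andP[_]; lra.
Unshelve. all: by end_near.
Qed.

Hypothesis cF : continuous (fun z : R * R => joint_cdf Q X Y z.1 z.2).

(** At a level y with H(y) > 0, G is the section F(., y) divided by the constant H(y), so it
    inherits continuity from F. *)
Lemma continuous_marginal_cdf_l : continuous (marginal_cdf Q X).
Proof.
have [y y0] := exists_marginal_cdf_gt0 Y.
have -> : marginal_cdf Q X = fun x => joint_cdf Q X Y x y / marginal_cdf Q Y y.
  by apply/funext => x; rewrite indep mulfK// gt_eqF.
move=> x; have h : joint_cdf Q X Y t y @[t --> x] --> joint_cdf Q X Y x y.
  exact: (cvg_comp2 cvg_id (cvg_cst y) (cF (x, y))).
exact: cvgM h (cvg_cst _).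
Qed.

Lemma continuous_marginal_cdf_r : continuous (marginal_cdf Q Y).
Proof.
have [x x0] := exists_marginal_cdf_gt0 X.
have -> : marginal_cdf Q Y = fun y => joint_cdf Q X Y x y / marginal_cdf Q X x.
  by apply/funext => y; rewrite indep mulrC mulKf// gt_eqF.
move=> y; have h : joint_cdf Q X Y x t @[t --> y] --> joint_cdf Q X Y x y.
  exact: (cvg_comp2 (cvg_cst x) cvg_id (cF (x, y))).
exact: cvgM h (cvg_cst _).
Qed.

(* With [U = G(X)] and [V = H(Y)] the integrals in [sigma2_S] are [U / 2] and
   [V / 2], so its integrand is [(2UV - U - V) / 2 + 1]. *)
Lemma sigma2_S_indep : sigma2_S Q X Y = 9 / 4 * sigma2_T Q X Y.
Proof.
have cG := continuous_marginal_cdf_l; have cH := continuous_marginal_cdf_r.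
rewrite /sigma2_S /sigma2_T.
have iY x : \int[distribution Q Y]_y joint_cdf Q X Y x y = marginal_cdf Q X x / 2.
  have bY := marginal_cdf_bounded_measurable Q Y.
  under eq_Rintegral do rewrite indep.
  rewrite RintegralZl//; last exact: bounded_measurable_integrable.
  by rewrite Rintegral_distribution// mean_marginal_cdf.
have iX y : \int[distribution Q X]_x joint_cdf Q X Y x y = marginal_cdf Q Y y / 2.
  have bX := marginal_cdf_bounded_measurable Q X.
  under eq_Rintegral do rewrite indep mulrC.
  rewrite RintegralZl//; last exact: bounded_measurable_integrable.
  by rewrite Rintegral_distribution// mean_marginal_cdf.
set Z := fun w => 2 * joint_cdf Q X Y (X w) (Y w) - _ - _.
have bZ : bounded_measurable Z.
  do 2 (apply: bounded_measurableB; last exact: bounded_measurable_marginal_cdf).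
  apply: bounded_measurableM; first exact: bounded_measurable_cst.
  exact: bounded_measurable_joint_cdf.
(* The factor 9/4 arises from 144 / 4 = 36 = (9/4) * 16. *)
rewrite [X in 144 * X](_ : _ = 2^-1 ^+ 2 * var Q Z); first by field.
rewrite -(var_affine _ _ 1)//; congr var; apply/funext => w.
by rewrite iX iY /Z indep; field.
Qed.

Variable P : probability Omega R.
Hypothesis eqG : marginal_cdf P X = marginal_cdf Q X.
Hypothesis eqH : marginal_cdf P Y = marginal_cdf Q Y.

Let a z := joint_cdf P X Y z.1 z.2 - joint_cdf Q X Y z.1 z.2.

Let mean_jointE (P' : probability Omega R) :
  mean P' (fun w => joint_cdf Q X Y (X w) (Y w)) =
  mean P' (fun w => marginal_cdf Q X (X w) * marginal_cdf Q Y (Y w)).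
Proof. by congr mean; apply/funext => w. Qed.

(** With both marginal means equal to 1/2, the swap identity becomes E_Q F_P = E_P F_Q = E_P G(X)
    H(Y), so E_Q a is the change in the mean of G(X) H(Y). *)
Lemma mu_S_sub : mu_S P X Y - mu_S Q X Y = 12 * mean Q (fun w => a (X w, Y w)).
Proof.
have cG := continuous_marginal_cdf_l; have cH := continuous_marginal_cdf_r.
(* Since the marginals agree, G is also the cdf of X under [P], and the value 1/2 applies there
   too. *)
have mG : mean P (fun w => marginal_cdf Q X (X w)) = 2^-1.
  by rewrite -eqG mean_marginal_cdf// eqG.
have mH : mean P (fun w => marginal_cdf Q Y (Y w)) = 2^-1.
  by rewrite -eqH mean_marginal_cdf// eqH.
rewrite meanB; try exact: bounded_measurable_joint_cdf.
rewrite (mean_joint_cdf_swap P)// mG mH !mean_jointE /mu_S eqG eqH; lra.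
Qed.

(** The change E_P F_P - E_Q F_Q is split at E_P F_Q: the first part is E_P a, and the second is E_Q
    a by the Spearman computation. *)
Lemma mu_T_sub : mu_T P X Y - mu_T Q X Y =
  4 * (mean P (fun w => a (X w, Y w)) + mean Q (fun w => a (X w, Y w))).
Proof.
have := mu_S_sub; rewrite /mu_S /mu_T eqG eqH -!mean_jointE => h.
rewrite (meanB P); try exact: bounded_measurable_joint_cdf.
lra.
Qed.

End independence.

(** * Limits at 0 and the cycle of implications *)

Lemma cvg_dnbhs_near_eq {R : realType} (f g : R -> R) (l : R) :
  (\forall t \near 0^', f t = g t) -> f t @[t --> 0^'] --> l ->
  g t @[t --> 0^'] --> l.
Proof. by move=> fg; apply: cvg_trans; exact: near_eq_cvg. Qed.

Theorem theorem3p2 (R : realType) (d : measure_display)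
    (Omega : measurableType d) (Theta : set R)
    (P : R -> probability Omega R) (X Y : {mfun Omega >-> R})
    (G H : R -> R) (Theta0 : set R) :
  open Theta -> is_interval Theta -> Theta 0 ->
  let F := fun theta => joint_cdf (P theta) X Y in
  (forall theta, Theta theta ->
     continuous (fun z : R * R => F theta z.1 z.2)) ->
  (forall theta, Theta theta -> forall x, marginal_cdf (P theta) X x = G x) ->
  (forall theta, Theta theta -> forall y, marginal_cdf (P theta) Y y = H y) ->
  (forall x y, F 0 x y = G x * H y) ->
  nbhs 0 Theta0 -> Theta0 `<=` Theta ->
  {within Theta0, continuous (fun theta => sigma_T (P theta) X Y)} ->
  {within Theta0, continuous (fun theta => sigma_S (P theta) X Y)} ->
  (forall theta, Theta0 theta -> 0 < sigma_T (P theta) X Y) ->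
  (forall theta, Theta0 theta -> 0 < sigma_S (P theta) X Y) ->
  (forall theta, Theta0 theta -> theta != 0 ->
     0 < (mu_T (P theta) X Y - mu_T (P 0) X Y) * theta) ->
  (forall theta, Theta0 theta -> theta != 0 ->
     0 < (mu_S (P theta) X Y - mu_S (P 0) X Y) * theta) ->
  let a := fun theta x y => F theta x y - G x * H y in
  let law := fun theta => joint_law (P theta) X Y in
  [<->
    (* (I) *)
    is_ARE_TS P X Y 1%E;
    (* (II) *)
    mean (P theta) (fun w => a theta (X w) (Y w))
      / mean (P 0) (fun w => a theta (X w) (Y w)) @[theta --> 0^'] --> (1 : R);
    (* (III) *)
    charge_integral (charge_diff (law theta) (law 0))
        (fun z => F theta z.1 z.2 - F 0 z.1 z.2)
      / (\int[law 0]_z (F theta z.1 z.2 - F 0 z.1 z.2))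
      @[theta --> 0^'] --> (0 : R);
    (* (III), restated with a *)
    charge_integral (charge_diff (law theta) (law 0))
        (fun z => a theta z.1 z.2)
      / (\int[law 0]_z a theta z.1 z.2) @[theta --> 0^'] --> (0 : R)].

Proof.
move=> _ _ T0 F cF eqG eqH indep T0nbhs T0sub _ _ sT0 _ muT muS a law.
have Th00 : Theta0 0 by exact: nbhs_singleton.
have mG t : Theta t -> marginal_cdf (P t) X = marginal_cdf (P 0) X.
  by move=> Tt; apply/funext => x; rewrite !eqG.
have mH t : Theta t -> marginal_cdf (P t) Y = marginal_cdf (P 0) Y.
  by move=> Tt; apply/funext => x; rewrite !eqH.
have ind x y : joint_cdf (P 0) X Y x y
    = marginal_cdf (P 0) X x * marginal_cdf (P 0) Y y.
  by rewrite eqG// eqH// -indep.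
have cF0 := cF 0 T0.
pose b t z := F t z.1 z.2 - F 0 z.1 z.2.
(* As F_0 = G H, both forms of (III) concern the same function [b t]. *)
have aE t x y : a t x y = b t (x, y) by rewrite /a -indep.
have bb t : bounded_measurable (b t).
  by apply: bounded_measurableB; exact: joint_cdf_bounded_measurable.
pose A t := mean (P t) (fun w => b t (X w, Y w)).
pose B t := mean (P 0) (fun w => b t (X w, Y w)).
have sigma2T_gt0 : 0 < sigma2_T (P 0) X Y by rewrite -sqrtr_gt0; exact: sT0.
have sigmaE : sigma2_S (P 0) X Y / sigma2_T (P 0) X Y = 9 / 4.
  by rewrite sigma2_S_indep// mulfK// gt_eqF.
have nearT : \forall t \near 0^', Theta0 t /\ t != 0.
  near=> t; split; last by near: t; exact: nbhs_dnbhs_neq.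
  by near: t; exact: nbhs_dnbhs.
have muSE t : Theta t -> mu_S (P t) X Y - mu_S (P 0) X Y = 12 * B t.
  by move=> Tt; rewrite mu_S_sub ?mG ?mH.
have muTE t : Theta t -> mu_T (P t) X Y - mu_T (P 0) X Y = 4 * (A t + B t).
  by move=> Tt; rewrite mu_T_sub ?mG ?mH.
(* The strict sign condition on mu_S excludes a vanishing denominator. *)
have B_neq0 t : Theta0 t -> t != 0 -> B t != 0.
  move=> Tt t0; have := muS t Tt t0; rewrite muSE; last exact: T0sub.
  by apply: contraTneq => ->; rewrite mulr0 mul0r ltxx.
(* Dividing the two sign conditions cancels theta and leaves (A/B + 1) / 3 > 0, with 3 = 12 / 4.
   This positivity is what lets the square in the efficiency be undone. *)
have ratio_gt0 t : Theta0 t -> t != 0 -> 0 < A t / B t + 1.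
  move=> Tt t0; have B0 := B_neq0 t Tt t0.
  have hS := muS t Tt t0; have hT := muT t Tt t0.
  have := divr_gt0 hT hS; rewrite muSE ?muTE; try exact: T0sub.
  rewrite (_ : _ / _ = (A t / B t + 1) / 3); first by rewrite pmulr_lgt0.
  by field; rewrite B0 t0.
pose rho t := (mu_T (P t) X Y - mu_T (P 0) X Y) ^+ 2
              / (mu_S (P t) X Y - mu_S (P 0) X Y) ^+ 2.
have rhoE t : Theta0 t -> t != 0 -> rho t = ((A t / B t + 1) / 3) ^+ 2.
  move=> Tt t0; rewrite /rho muSE ?muTE; try exact: T0sub.
  by field; exact: B_neq0.
have IIE : (fun t => mean (P t) (fun w => a t (X w) (Y w))
    / mean (P 0) (fun w => a t (X w) (Y w))) = fun t => A t / B t.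
  apply/funext => t; rewrite /A /B.
  have -> // : (fun w => a t (X w) (Y w)) = fun w => b t (X w, Y w).
  by apply/funext => w; rewrite aE.
have IIIE t : charge_integral (charge_diff (law t) (law 0)) (b t)
    / (\int[law 0]_z b t z) = (A t - B t) / B t.
  by rewrite charge_integral_diff// !joint_lawE.
have III'E t : (fun z => a t z.1 z.2) = b t.
  by apply/funext => -[x y]; rewrite aE.
tfae.
- case=> l cl lE; rewrite IIE.
  (* An infinite limit times 9/4 stays infinite, so the efficiency 1 forces a finite limit, namely
     4/9. *)
  have lE' : l = (4 / 9)%:E.
    case: l lE {cl} => [r||]; rewrite sigmaE.
    + by rewrite -EFinM => -[?]; congr (_%:E); lra.
    + by rewrite gt0_muley ?lte_fin//; lra.
    + by rewrite gt0_muleNy ?lte_fin//; lra.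
  rewrite lE' in cl.
  have crho : rho t @[t --> 0^'] --> (4 / 9 : R) by exact: fine_cvg cl.
  have csq := cvg_comp _ _ crho (@sqrt_continuous R (4 / 9)).
  (* Near 0 the square root of [rho] is (A/B + 1) / 3 without absolute value; solving for A/B gives
     this expression, with limit 3 * (2/3) - 1 = 1. *)
  apply: (@cvg_dnbhs_near_eq _ (fun t => 3 * Num.sqrt (rho t) - 1)).
    near=> t; have [Tt t0] : Theta0 t /\ t != 0 by near: t.
    rewrite rhoE// sqrtr_sqr ger0_norm; first by field; exact: B_neq0.
    by rewrite divr_ge0// ltW// ratio_gt0.
  have sqE : 3 * Num.sqrt (4 / 9) - 1 = 1 :> R.
    rewrite (_ : 4 / 9 = (2 / 3) ^+ 2); last by field.
    by rewrite sqrtr_sqr ger0_norm ?divr_ge0//; field.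
  rewrite -[X in _ --> X]sqE.
  exact: cvgB (cvgM (cvg_cst (3 : R)) csq) (cvg_cst (1 : R)).
- rewrite IIE => II.
  apply: (@cvg_dnbhs_near_eq _ (fun t => A t / B t - 1)).
    near=> t; have [Tt t0] : Theta0 t /\ t != 0 by near: t.
    by rewrite IIIE mulrBl divff// B_neq0.
  rewrite -[X in _ --> X](subrr 1); exact: cvgB II (cvg_cst _).
- by under [in X in _ -> X]eq_fun do rewrite III'E.
- under eq_fun do rewrite III'E IIIE.
  move=> III; exists (4 / 9)%:E; last first.
    by rewrite sigmaE -EFinM; congr (_%:E); field.
  apply: cvg_EFin; first by near=> t.
  (* The ratio of (III) is A/B - 1 where B is nonzero, hence the shift by 2 in place of 1; the limit
     is then (2/3)^2 = 4/9. *)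
  apply: (@cvg_dnbhs_near_eq _ (fun t => (((A t - B t) / B t + 2) / 3) ^+ 2)).
    near=> t; have [Tt t0] : Theta0 t /\ t != 0 by near: t.
    by rewrite /= -/(rho t) rhoE//; field; exact: B_neq0.
  have -> : 4 / 9 = ((0 + 2) / 3) * ((0 + 2) / 3) :> R by field.
  have c : ((A t - B t) / B t + 2) / 3 @[t --> 0^'] --> ((0 + 2) / 3 : R).
    exact: cvgM (cvgD III (cvg_cst (2 : R))) (cvg_cst (3^-1 : R)).
  exact: (cvgM c c).
Unshelve. all: by end_near.
Qed.
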